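(* Let $C\subset\mathbb{R}^N$ be any non-empty closed convex set with support function $h$, whose normalized effective domain is $$S_h=\{\alpha\in S_N : h(\alpha)\text{ is finite}\}=(E_h\setminus\{0\})\cap S_N,$$ where $E_h$ is the effective domain of $h$. Let $\mathcal{C}$ be any countable dense subset of $S_h$. Then $$C=\bigcap_{\alpha\in\mathcal{C}}\{s\in\mathbb{R}^N : A_\alpha(s)\le 0\},$$ where $A_\alpha(s)=\langle\alpha,s\rangle-h(\alpha)$.
   Context: $S_N$ is the unit sphere of the $l^1$-norm on $\mathbb{R}^N$. The support function of $C$ is $h(u)=\sup\{\langle x,u\rangle: x\in C\}\in(-\infty,\infty]$ for $u\in\mathbb{R}^N$, and its effective domain is $E_h=\{u\in\mathbb{R}^N: h(u)<\infty\}$. An intersection over the empty index set is $\mathbb{R}^N$. *)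

(* Defs.v *)
From HB Require Import structures.
From mathcomp Require Import all_boot all_order all_algebra.
From mathcomp Require Import all_classical all_reals all_analysis.

Set Implicit Arguments.
Unset Strict Implicit.
Unset Printing Implicit Defensive.

Import Order.TTheory GRing.Theory Num.Theory.
Import numFieldNormedType.Exports.

Local Open Scope classical_set_scope.
Local Open Scope ring_scope.

(* The topology of 'rV[R]_N is induced by the sup norm, hence is the usual
   topology of R^N. *)

Definition dotv (R : realType) (N : nat) (x y : 'rV[R]_N) : R :=
  \sum_(i < N) x 0 i * y 0 i.

Definition l1norm (R : realType) (N : nat) (x : 'rV[R]_N) : R :=
  \sum_(i < N) `|x 0 i|.

Definition l1sphere (R : realType) (N : nat) : set 'rV[R]_N :=
  [set u | l1norm u = 1].

Arguments l1sphere R N : clear implicits.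

Definition support_fun (R : realType) (N : nat) (C : set 'rV[R]_N)
    (u : 'rV[R]_N) : \bar R :=
  ereal_sup [set (dotv x u)%:E | x in C].

Definition eff_dom (R : realType) (N : nat) (C : set 'rV[R]_N) :
    set 'rV[R]_N :=
  [set u | (support_fun C u < +oo)%E].

Definition normalized_eff_dom (R : realType) (N : nat) (C : set 'rV[R]_N) :
    set 'rV[R]_N :=
  [set a | l1sphere R N a /\ support_fun C a \is a fin_num].

Lemma normalized_eff_domE (R : realType) (N : nat) (C : set 'rV[R]_N) :
  C !=set0 ->
  normalized_eff_dom C = (eff_dom C `\` [set 0]) `&` l1sphere R N.
Proof.
move=> [x Cx]; apply/seteqP; split => u /=.
  move=> [u1 hu]; split=> //; split; first by rewrite /eff_dom /= ltey_eq hu.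
  move=> u0; move: u1; rewrite u0 /l1sphere /= /l1norm big1.
    by move/esym/eqP; rewrite oner_eq0.
  by move=> i _; rewrite mxE normr0.
move=> [[hu _] u1]; split=> //.
rewrite fin_numElt hu andbT (lt_le_trans (ltNyr (dotv x u)))//.
by apply: ereal_sup_ubound; exists x.
Qed.

(* Density is relative to the subspace topology of S. *)
Definition dense_subset (T : topologicalType) (S D : set T) : Prop :=
  D `<=` S /\ S `<=` closure D.

(* Real-valued when support_fun C a is finite, in particular on
   normalized_eff_dom C. *)
Definition support_gap (R : realType) (N : nat) (C : set 'rV[R]_N)
    (a s : 'rV[R]_N) : \bar R :=
  ((dotv a s)%:E - support_fun C a)%E.

(* Main.v *)
(** A point [s] outside [C] is strictly separated from [C]: some [a] has
    [h a < <a, s>]. As [h] is only lower semicontinuous, it may be much larger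
    on a dense set near [a]. But the effective domain is a convex cone; take
    finitely many [b_i] in it spanning its linear hull. For small [c_i >= 0],
    sublinearity of [h] keeps [h q < <q, s>] at [q = a + sum_i c_i b_i], and
    these [q] contain a relative neighborhood of [p = a + sum_i e b_i] in the
    effective domain. So a positive multiple of some member of the dense set is
    such a [q], and [<a, s> <= h a] already fails on the dense set. *)

Require Import Defs.
From mathcomp Require Import all_boot all_order all_algebra.
From mathcomp Require Import all_classical all_reals all_analysis.
From mathcomp Require Import ring lra.
Import Order.TTheory GRing.Theory Num.Theory.
Import numFieldNormedType.Exports.

Local Open Scope classical_set_scope.
Local Open Scope ring_scope.

Section DotProduct.
Context {R : realType} {N : nat}.
Implicit Types (x y u v : 'rV[R]_N) (k : R).

Lemma dotvC x y : dotv x y = dotv y x.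
Proof. by apply: eq_bigr => i _; rewrite mulrC. Qed.

Lemma dotvDr x u v : dotv x (u + v) = dotv x u + dotv x v.
Proof.
by rewrite /dotv -big_split/=; apply: eq_bigr => i _; rewrite mxE mulrDr.
Qed.

Lemma dotvZr k x u : dotv x (k *: u) = k * dotv x u.
Proof. by rewrite /dotv mulr_sumr; apply: eq_bigr => i _; rewrite mxE mulrCA. Qed.

Lemma dotvNr x u : dotv x (- u) = - dotv x u.
Proof. by rewrite -scaleN1r dotvZr mulN1r. Qed.

Lemma dotv0r x : dotv x 0 = 0.
Proof. by rewrite -(scale0r 0) dotvZr mul0r. Qed.

Lemma dotvDl x y u : dotv (x + y) u = dotv x u + dotv y u.
Proof. by rewrite dotvC dotvDr !(dotvC u). Qed.

Lemma dotvZl k x u : dotv (k *: x) u = k * dotv x u.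
Proof. by rewrite dotvC dotvZr (dotvC u). Qed.

Lemma dotvNl x u : dotv (- x) u = - dotv x u.
Proof. by rewrite dotvC dotvNr (dotvC u). Qed.

Lemma dotv_sumr (I : finType) x (F : I -> 'rV[R]_N) :
  dotv x (\sum_i F i) = \sum_i dotv x (F i).
Proof. by apply: (big_morph (dotv x)) => [u v|]; rewrite ?dotvDr ?dotv0r. Qed.

Lemma mulmx_dotv m x (A : 'M[R]_(N, m)) j : (x *m A) 0 j = dotv x (col j A)^T.
Proof. by rewrite mxE; apply: eq_bigr => i _; rewrite !mxE. Qed.

Lemma dotv_sqr_coord x i : x 0 i ^+ 2 <= dotv x x.
Proof.
rewrite /dotv (bigD1 i)//= -expr2 lerDl.
by apply: sumr_ge0 => j _; rewrite -expr2 sqr_ge0.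
Qed.

Lemma dotv_gt0 x : x != 0 -> 0 < dotv x x.
Proof.
move=> /rV0Pn[i xi0]; apply: lt_le_trans (dotv_sqr_coord x i).
by rewrite exprn_even_gt0.
Qed.

Lemma dotv_ge0 x : 0 <= dotv x x.
Proof. by apply: sumr_ge0 => i _; rewrite -expr2 sqr_ge0. Qed.

Lemma dotv_sqrB k u v :
  dotv (k *: u - v) (k *: u - v) =
  k ^+ 2 * dotv u u - 2 * k * dotv u v + dotv v v.
Proof.
by rewrite dotvDr dotvNr dotvZr !dotvDl !dotvNl !dotvZl (dotvC v u); ring.
Qed.

Lemma continuous_dotv (T : topologicalType) (f g : T -> 'rV[R]_N) :
  continuous f -> continuous g -> continuous (fun t => dotv (f t) (g t)).
Proof.
have coordc (h : T -> 'rV[R]_N) i :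
    continuous h -> continuous (fun t => h t 0 i).
  move=> ch t.
  exact: (continuous_comp (ch t) (@coord_continuous R _ _ 0 i (h t))).
move=> cf cg; apply: (@continuous_big R _ +%R 0 xpredT) => [|i _ t].
  exact: add_continuous.
by apply: cvgM; exact: coordc.
Qed.

Lemma l1norm_gt0 x : x != 0 -> 0 < l1norm x.
Proof.
move=> /rV0Pn[i xi0]; rewrite /l1norm (bigD1 i)//= ltr_pwDl ?normr_gt0//.
exact: sumr_ge0.
Qed.

Lemma l1normZ k x : 0 <= k -> l1norm (k *: x) = k * l1norm x.
Proof.
move=> k0; rewrite /l1norm mulr_sumr; apply: eq_bigr => i _.
by rewrite mxE normrM ger0_norm.
Qed.

End DotProduct.

Lemma continuous_scale_shift {R : realType} (T : topologicalType)
    (f : T -> R) k b :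
  continuous f -> continuous (fun t => k * f t - b).
Proof.
by move=> fc t; apply: cvgB; [apply: cvgMr; exact: fc|exact: cvg_cst].
Qed.

Section SupportFunction.
Context {R : realType} {N : nat}.
Implicit Types (C : set 'rV[R]_N) (u : 'rV[R]_N).

Lemma support_fun_le C u M :
  (support_fun C u <= M%:E)%E <-> forall x, C x -> dotv x u <= M.
Proof.
split=> [uM x Cx|uM].
  by rewrite -lee_fin; apply: le_trans uM; apply: ereal_sup_ubound; exists x.
by apply: ge_ereal_sup => _ [x Cx <-]; rewrite lee_fin uM.
Qed.

Lemma eff_domP C u : C !=set0 ->
  eff_dom C u <-> exists M, forall x, C x -> dotv x u <= M.
Proof.
move=> [x0 Cx0]; split=> [hu|[M uM]].
  exists (fine (support_fun C u)); apply/support_fun_le.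
  (* A point of [C] keeps the supremum above -oo, so [fine] returns its true value. *)
  have hx0 : ((dotv x0 u)%:E <= support_fun C u)%E.
    by apply: ereal_sup_ubound; exists x0.
  by rewrite fineK// fin_numElt (lt_le_trans (ltNyr _) hx0).
by move/support_fun_le: uM => /le_lt_trans; apply; exact: ltry.
Qed.

End SupportFunction.

(** The points of [C] no farther from [s] than a given [x0] form a compact set, on which the squared
    Euclidean distance attains its minimum; all other points of [C] are farther still. *)
Lemma closest_point {R : realType} {N : nat} (C : set 'rV[R]_N) s :
  C !=set0 -> closed C ->
  exists2 y, C y & forall x, C x -> dotv (y - s) (y - s) <= dotv (x - s) (x - s).
Proof.
move=> [x0 Cx0] Ccl.
pose q (x : 'rV[R]_N) := dotv (x - s) (x - s).
have qc : continuous q.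
  have sc : continuous (fun x : 'rV[R]_N => x - s).
    move=> x; apply: (@cvgB _ _ _ (nbhs (x : 'rV[R]_N)) _ id (cst s)).
      exact: cvg_id.
    exact: cvg_cst.
  exact: continuous_dotv.
pose A := C `&` [set x | q x <= q x0].
have Acl : closed A.
  apply: closedI => //; apply: (@closed_comp _ _ q [set t | t <= q x0]).
    by move=> x _; exact: qc.
  exact: closed_le.
have Abd : bounded_set A.
  (* Each coordinate of [x - s] has square at most [q x0], hence absolute value at most [q x0 + 1];
     this avoids a square root. *)
  exists (`|s| + (q x0 + 1)); split; first by rewrite num_real.
  move=> M sM x [_ /= xx0]; apply: le_trans (ltW sM).
  rewrite -[x](subrK s) addrC; apply: le_trans (ler_normD _ _) _; rewrite lerD2l.
  have q0 : 0 <= q x0 by exact: dotv_ge0.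
  rewrite [leLHS]mx_normrE; apply: bigmax_le => [|[i j] _ /=]; first lra.
  rewrite (ord1 i); have := le_trans (dotv_sqr_coord (x - s) j) xx0.
  rewrite -real_normK ?num_real//; have := normr_ge0 ((x - s) 0 j); nra.
have [|y] := EVT_min_rV _ (bounded_closed_compact Abd Acl)
  (continuous_subspaceT qc); first by exists x0; split=> /=.
rewrite inE => -[Cy yx0] ymin; exists y => // x Cx.
have [xx0|x0x] := leP (q x) (q x0); first by apply: ymin; rewrite inE.
exact: le_trans yx0 (ltW x0x).
Qed.

(** The normal is [s - y], with [y] the point of [C] closest to [s]: if some [x] in [C] lay beyond
    the hyperplane through [y], the segment from [y] to [x] would come closer to [s]. *)
Lemma strict_separation {R : realType} {N : nat} (C : set 'rV[R]_N) s :
  C !=set0 -> closed C -> convex_set C -> ~ C s ->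
  exists a M, (forall x, C x -> dotv x a <= M) /\ M < dotv s a.
Proof.
move=> C0 Ccl Ccv Cs; have [y Cy ymin] := closest_point _ s C0 Ccl.
exists (s - y), (dotv y (s - y)); split; last first.
  rewrite -subr_gt0 -dotvNl -dotvDl dotv_gt0// subr_eq0.
  by apply/eqP => sy; apply: Cs; rewrite sy.
move=> x Cx; rewrite -subr_le0 -dotvNl -dotvDl.
set b := dotv (x - y) (s - y); set c := dotv (x - y) (x - y).
(* Moving from [y] to [t *: x + (1 - t) *: y] changes the squared distance to [s] by exactly this
   product. *)
have key t : 0 <= t <= 1 -> 0 <= t * (t * c - 2 * b).
  move=> /andP[t0 t1].
  have : C (t *: x + (1 - t) *: y).
    by have := Ccv x y (Itv01 t0 t1); rewrite !inE; apply.
  move=> /ymin.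
  have -> : t *: x + (1 - t) *: y - s = t *: (x - y) - (s - y).
    by apply/rowP => i; rewrite !mxE; ring.
  rewrite dotv_sqrB -(opprB s y) dotvNl dotvNr opprK -/b -/c; lra.
have c0 : 0 <= c by exact: dotv_ge0.
rewrite leNgt; apply/negP => b0.
have bc : 0 < b + c by lra.
(* This [t] is at most 1 and gives [t * c <= b < 2 * b], against [key]. *)
have := key (b / (b + c)); rewrite divr_ge0 ?(ltW b0) ?(ltW bc)//=.
rewrite ler_pdivrMr// mul1r lerDl c0 => /(_ isT).
rewrite pmulr_rge0 ?divr_gt0// mulrAC subr_ge0 ler_pdivlMr//; nra.
Qed.

(** Take a finite family in [E] of maximal rank: appending a further member of [E] cannot raise the
    rank, so that member already lies in the row space. *)
Lemma exists_spanning_rows {F : fieldType} {N : nat} (E : set 'rV[F]_N) :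
  exists m (B : 'M[F]_(m, N)),
    (forall i, E (row i B)) /\ forall e, E e -> (e <= B)%MS.
Proof.
pose P r := `[< exists m (B : 'M[F]_(m, N)),
  (forall i, E (row i B)) /\ \rank B = r >].
have P0 : exists r, P r.
  exists 0; apply/asboolP; exists 0, 0; split=> [[]//|]; exact: mxrank0.
have PN r : P r -> (r <= N)%N.
  by move=> /asboolP[m [B [_ <-]]]; exact: rank_leq_col.
case: (ex_maxnP P0 PN) => r /asboolP[m [B [BE Br]]] rmax.
exists m, B; split=> // e Ee.
have : P (\rank (col_mx B e)).
  apply/asboolP; exists (m + 1)%N, (col_mx B e); split=> // i.
  case: (splitP i) => j ij.
    by rewrite (_ : i = lshift 1 j) ?rowKu//; exact: val_inj.
  by rewrite (_ : i = rshift m j) ?rowKd ?row_id//; exact: val_inj.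
move=> /rmax; rewrite -Br => rk.
have /andP[Bsub _] : (B <= col_mx B e)%MS && (e <= col_mx B e)%MS.
  by rewrite -col_mx_sub.
have [_] := mxrank_leqif_sup Bsub.
by rewrite eqn_leq rk mxrankS// => /esym; rewrite col_mx_sub => /andP[].
Qed.

Lemma strict_support_dense {R : realType} {N : nat} (C : set 'rV[R]_N) D s a M :
  C !=set0 -> dense_subset (normalized_eff_dom C) D ->
  (forall x, C x -> dotv x a <= M) -> M < dotv s a ->
  exists2 q, D q & (support_fun C q < (dotv s q)%:E)%E.
Proof.
move=> C0 [DS SD] aM Ms; have [x0 Cx0] := C0.
have [m [B [BE Bspan]]] := exists_spanning_rows (eff_dom C).
have /choice[d dB] : forall i, exists d, forall x, C x -> dotv x (row i B) <= d.
  by move=> i; apply/(eff_domP C).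
(* Each unit of the coefficient of [row i B] costs [K i] of the margin [dotv s a - M]. *)
pose K i := d i - dotv s (row i B); pose T := \sum_i `|K i|.
have T0 : 0 <= T by exact: sumr_ge0.
pose del := dotv s a - M; have del0 : 0 < del by rewrite subr_gt0.
(* Coefficients up to [2 * e] cost at most [2 * e * T], less than half of [del]; the [+ 1] covers
   [T = 0]. *)
pose e := del / (4 * (T + 1)).
have e0 : 0 < e by rewrite divr_gt0//; lra.
have eT : 2 * e * T < del.
  have : e * (4 * (T + 1)) = del by rewrite divfK//; lra.
  by nra.
have gap (c : 'I_m -> R) : (forall i, 0 <= c i <= 2 * e) ->
    let q := a + \sum_i c i *: row i B in
    exists2 b, (forall x, C x -> dotv x q <= b) & b < dotv s q.
  move=> c0e q; exists (M + \sum_i c i * d i).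
    move=> x Cx; rewrite dotvDr lerD ?aM// dotv_sumr ler_sum// => i _.
    by rewrite dotvZr ler_wpM2l ?dB//; case/andP: (c0e i).
  rewrite dotvDr dotv_sumr -subr_gt0.
  have -> : \sum_i dotv s (c i *: row i B) =
      \sum_i c i * d i - \sum_i c i * K i.
    by rewrite -sumrB; apply: eq_bigr => i _; rewrite dotvZr /K; ring.
  have : \sum_i c i * K i <= 2 * e * T.
    rewrite mulr_sumr ler_sum// => i _; have /andP[ci0 ci1] := c0e i.
    apply: le_trans (ler_wpM2l ci0 (ler_norm _)) _.
    exact: ler_wpM2r.
  by move: eT; rewrite /del; lra.
(* All coefficients sit at the midpoint of [0, 2e], so each may move by less than [e] either way and
   [gap] still applies. *)
pose p := a + \sum_i e *: row i B.
have [|bp pC sp] := gap (fun=> e); first by move=> i; lra.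
(* At [p = 0] the two bounds from [gap] would read 0 <= [bp] < 0. *)
have p0 : p != 0.
  apply/eqP => p0; have := pC _ Cx0; rewrite -/p p0 dotv0r leNgt => /negP; apply.
  by move: sp; rewrite -/p p0 dotv0r.
pose n := l1norm p; have n0 : 0 < n by exact: l1norm_gt0.
have Ep : eff_dom C p by apply/eff_domP => //; exists bp.
have Sp : normalized_eff_dom C (n^-1 *: p).
  rewrite normalized_eff_domE//; split; last first.
    by rewrite /l1sphere/= l1normZ ?invr_ge0 ?(ltW n0)// mulVf ?gt_eqF.
  split; last by apply/eqP; rewrite scaler_eq0 invr_eq0 gt_eqF.
  apply/eff_domP => //; exists (n^-1 * bp) => x Cx.
  by rewrite dotvZr ler_wpM2l ?invr_ge0 ?(ltW n0)// pC.
(* Coordinates of [n *: y - p] along the rows of [B] whenever it lies in their span; they depend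
   continuously on [y] and vanish at [n^-1 *: p]. *)
pose f (y : 'rV[R]_N) i := ((n *: y - p) *m pinvmx B) 0 i.
have : \forall y \near (n^-1 *: p : 'rV[R]_N), forall i, `|f y i| < e.
  apply: (@filter_forall _ _ (fun i y => `|f y i| < e)
    (nbhs (n^-1 *: p : 'rV[R]_N))) => i.
  have fc : continuous (f ^~ i).
    pose v := (col i (pinvmx B))^T.
    rewrite (_ : f ^~ i = fun y => n * dotv y v - dotv p v); last first.
      by apply/funext => y; rewrite /f mulmx_dotv dotvDl dotvNl dotvZl.
    apply: continuous_scale_shift.
    apply: (@continuous_dotv _ _ _ id (cst v)); first by move=> z; exact: cvg_id.
    exact: cst_continuous.
  have f0 : f (n^-1 *: p) i = 0.
    by rewrite /f scalerA divff ?gt_eqF// scale1r subrr mul0mx mxE.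
  move/cvgr_dist_lt : (fc (n^-1 *: p)) => /(_ e e0); rewrite f0.
  by apply: filterS => y; rewrite sub0r normrN.
move=> /(SD _ Sp)[q [Dq /= fq]]; exists q => //.
have Eq : eff_dom C q by have := DS _ Dq; rewrite normalized_eff_domE// => -[[]].
(* The rows of B need not be independent: since [n q - p] lies in their span,
   [pinvmx B] supplies coordinates that are small when [n q] is close to [p]. *)
have nq : n *: q = a + \sum_i (e + f q i) *: row i B.
  (* Both [q] and [p] belong to the effective domain, which [B] spans. *)
  have sub : (n *: q - p <= B)%MS.
    apply: addmx_sub; first by rewrite scalemx_sub ?Bspan.
    by rewrite -scaleN1r scalemx_sub ?Bspan.
  have := mulmxKpV sub; rewrite mulmx_sum_row => /eqP.
  rewrite -[_ == _](inj_eq (addIr p)) subrK => /eqP <-.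
  rewrite addrC -addrA -big_split/=; congr (_ + _); apply: eq_bigr => i _.
  by rewrite scalerDl.
have [|b qC sq] := gap (fun i => e + f q i).
  by move=> i; move: (fq i); rewrite ltr_norml => /andP[? ?]; lra.
move: qC sq; rewrite /= -nq => qC sq.
(* The strict gap at [n *: q] passes to [q] by positive homogeneity. *)
apply: (@le_lt_trans _ _ (n^-1 * b)%:E).
  apply/support_fun_le => x Cx.
  by rewrite ler_pdivlMl// -dotvZr qC.
by rewrite lte_fin ltr_pdivrMl// -dotvZr.
Qed.

Theorem theorem3p1 (R : realType) (N : nat) (C : set 'rV[R]_N)
    (C_nonempty : C !=set0) (C_closed : closed C) (C_convex : convex_set C)
    (D : set 'rV[R]_N) (D_countable : countable D)
    (D_dense : dense_subset (normalized_eff_dom C) D) :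
  C = \bigcap_(a in D) [set s | (support_gap C a s <= 0)%E].
Proof.
apply/seteqP; split => [s Cs a /(proj1 D_dense)[_ afin]|s sD].
  rewrite /= /support_gap sube_le0.
  by apply: ereal_sup_ubound; exists s => //; rewrite dotvC.
apply: contrapT => Cs.
have [a [M [aM Ms]]] := strict_separation C s C_nonempty C_closed C_convex Cs.
have [q Dq] := strict_support_dense C D s a M C_nonempty D_dense aM Ms.
rewrite ltNge => /negP; apply.
have [_ qfin] := (proj1 D_dense) _ Dq.
by have := sD _ Dq; rewrite /= /support_gap sube_le0// dotvC.
Qed.
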